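(* Let $\mu$ be a finite Borel measure in $\mathbb{R}^d$. Then $\mu\ll\mathscr{L}^d$ if and only if $$\lim_{\lambda\to+\infty}\lambda\,\mathscr{L}^d\big(\{x\in\mathbb{R}^d : \mathsf{M}\mu(x)>\lambda\}\big)=0.$$
   Context: $\mathscr{L}^d$ is the Lebesgue measure on $\mathbb{R}^d$, $B(x,r)$ is the ball of center $x$ and radius $r$, and $|\mu|$ is the total variation measure of $\mu$. The Hardy–Littlewood maximal function of $\mu$ at $x\in\mathbb{R}^d$ is $$\mathsf{M}\mu(x):=\sup_{r>0}\frac{|\mu|(B(x,r))}{\mathscr{L}^d(B(x,r))}\in[0,+\infty].$$ The notation $\mu\ll\mathscr{L}^d$ means that $\mu$ is absolutely continuous with respect to $\mathscr{L}^d$. *)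

(* Defs.v *)
From HB Require Import structures.
From mathcomp Require Import all_boot all_order all_algebra.
From mathcomp Require Import all_classical all_reals all_analysis measurable_realfun.

Set Implicit Arguments.
Unset Strict Implicit.
Unset Printing Implicit Defensive.

Import Order.TTheory GRing.Theory Num.Theory.
Import numFieldNormedType.Exports.

Local Open Scope classical_set_scope.
Local Open Scope ring_scope.

(* R^d with its Borel sigma-algebra. The topology on ['rV[R]_d] is that of the
   max norm, i.e., the usual one. *)
Notation borelRV R d := (g_sigma_algebraType [set U : set 'rV[R]_d | open U]).

Section borelRV_measurability.
Context (R : realType) (n : nat).

Lemma measurable_coordRV (i : 'I_n) :
  measurable_fun [set: borelRV R n]
    ((fun v => v ord0 i) : borelRV R n -> measurableTypeR R).
Proof.
apply: (measurability _ (RGenOpens.measurableE R)).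
move=> _ [_ [a [b ->] <-]]; rewrite setTI.
apply: sub_sigma_algebra; apply: (@open_comp 'rV[R]_n R).
  by move=> v _; exact: coord_continuous.
exact: interval_open.
Qed.

Lemma open_ratRV (U : set 'rV[R]_n) : open U ->
  U = \bigcup_(p : 'rV[rat]_n * nat)
    [set v | ball (map_mx ratr p.1 : 'rV[R]_n) (p.2.+1%:R^-1) v
           /\ ball (map_mx ratr p.1 : 'rV[R]_n) (p.2.+1%:R^-1) `<=` U].
Proof.
move=> oU; apply/seteqP; split => [x Ux|x [p _ [/= px pU]]]; last exact: pU.
have := open_nbhs_nbhs (conj oU Ux) => /nbhs_ballP[e /= e0 xeU].
pose k := Num.truncn (2 / e); pose r : R := k.+1%:R^-1.
have r0 : 0 < r by rewrite invr_gt0.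
have re : r + r < e.
  rewrite -mulr2n -(mulr_natl r) ltr_pdivrMr// mulrC -ltr_pdivrMr//.
  exact: truncnS_gt.
have /choice[c cE] : forall i : 'I_n, exists q : rat, ball (x ord0 i) r (ratr q).
  move=> i; have [||y [xq [q _ qy]]] := @dense_rat R (ball (x ord0 i) r).
  - by exists (x ord0 i); exact: ballxx.
  - exact: ball_open.
  by exists q; rewrite qy.
have xc : ball (map_mx ratr (\row_i c i) : 'rV[R]_n) r x.
  by split => // i j; rewrite !mxE ord1; exact: ball_sym.
exists (\row_i c i, k) => //=; split => // y cy; apply: xeU.
by apply: le_ball (ltW re) _ _; apply: ball_triangle (ball_sym xc) cy.
Qed.

Lemma measurable_fun_RV d (T : measurableType d) (f : T -> borelRV R n) :
  (forall i, measurable_fun [set: T]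
    ((fun t => f t ord0 i) : T -> measurableTypeR R)) ->
  measurable_fun [set: T] f.
Proof.
move=> mf; apply: (@measurability _ _ _ (borelRV R n) _ _ [set U : set 'rV[R]_n | open U]) => //.
move=> _ [U oU <-]; rewrite setTI (open_ratRV oU) preimage_bigcup.
apply: countable_bigcupT_measurable; first exact: countableP.
move=> [c k].
have [cU|cU] := pselect (ball (map_mx ratr c : 'rV[R]_n) (k.+1%:R^-1) `<=` U);
  last first.
  by rewrite [X in measurable X](_ : _ = set0)// -subset0 => t [].
rewrite [X in measurable X](_ : _ = \bigcap_(i : 'I_n)
    [set t | ball (ratr (c ord0 i) : R) (k.+1%:R^-1) (f t ord0 i)]); last first.
  apply/seteqP; split => [t [[_ ct] _] i _/=|t ct]; first by have := ct ord0 i; rewrite mxE.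
  split => //; split => [|i j]; first by rewrite invr_gt0.
  by rewrite ord1 mxE; exact: ct.
apply: fin_bigcap_measurable => // i _.
rewrite -[X in measurable X]setTI; apply: mf => //.
by apply: open_measurable; exact: ball_open.
Qed.

End borelRV_measurability.

Section lebesgueRV.
Local Open Scope ereal_scope.
Context (R : realType).

Definition consRV n (p : measurableTypeR R * borelRV R n) : borelRV R n.+1 :=
  row_mx (const_mx p.1 : 'rV[R]_1) (p.2 : 'rV[R]_n).

Definition unconsRV n (v : borelRV R n.+1) : measurableTypeR R * borelRV R n :=
  (v ord0 ord0, \row_j v ord0 (lift ord0 j)).

Lemma consRV0 n p : @consRV n p ord0 ord0 = p.1.
Proof.
have -> : ord0 = lshift n ord0 :> 'I_(1 + n) by exact: val_inj.
exact: etrans (row_mxEl (const_mx p.1 : 'rV[R]_1) _ _ _) (mxE _ _ _ _).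
Qed.

Lemma consRVS n p (j : 'I_n) : @consRV n p ord0 (lift ord0 j) = p.2 ord0 j.
Proof.
have -> : lift ord0 j = rshift 1 j :> 'I_(1 + n) by exact: val_inj.
exact: (row_mxEr (const_mx p.1 : 'rV[R]_1)).
Qed.

Lemma consRVK n : cancel (@consRV n) (@unconsRV n).
Proof.
move=> [x v]; rewrite /unconsRV consRV0; congr pair.
by apply/rowP => j; rewrite mxE consRVS.
Qed.

Lemma unconsRVK n : cancel (@unconsRV n) (@consRV n).
Proof.
move=> v; apply/rowP => j.
by case: (unliftP ord0 j) => [k ->|->]; rewrite ?consRVS ?consRV0 ?mxE.
Qed.

Lemma measurable_consRV n : measurable_fun [set: _] (@consRV n).
Proof.
apply: measurable_fun_RV => i; case: (unliftP ord0 i) => [k ->|->].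
  rewrite [X in measurable_fun _ X](_ : _ =
    (fun v : borelRV R n => v ord0 k : measurableTypeR R) \o snd); last first.
    by apply/funext => p; exact: consRVS.
  by apply: measurableT_comp (measurable_coordRV _) _; exact: measurable_snd.
rewrite [X in measurable_fun _ X](_ : _ = fst); first exact: measurable_fst.
by apply/funext => p; exact: consRV0.
Qed.

Lemma measurable_unconsRV n : measurable_fun [set: _] (@unconsRV n).
Proof.
apply: measurable_fun_pair; first exact: measurable_coordRV.
apply: measurable_fun_RV => i.
rewrite [X in measurable_fun _ X](_ : _ =
  (fun v : borelRV R n.+1 => v ord0 (lift ord0 i) : measurableTypeR R)).
  exact: measurable_coordRV.
by apply/funext => v; exact: mxE.
Qed.

HB.instance Definition _ n :=
  isMeasurableFun.Build _ _ _ _ (@consRV n) (@measurable_consRV n).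

Section succ.
Variables (n : nat) (m : {sigma_finite_measure set (borelRV R n) -> \bar R}).

Definition lebesgueRV_succ : set (borelRV R n.+1) -> \bar R :=
  pushforward (@lebesgue_measure R \x m) (@consRV n).

Let lebesgueRV_succ0 : lebesgueRV_succ set0 = 0.
Proof. exact: measure0. Qed.

Let lebesgueRV_succ_ge0 A : 0 <= lebesgueRV_succ A.
Proof. exact: measure_ge0. Qed.

Let lebesgueRV_succ_sigma_additive : semi_sigma_additive lebesgueRV_succ.
Proof. exact: measure_semi_sigma_additive. Qed.

HB.instance Definition _ := isMeasure.Build _ _ _ lebesgueRV_succ
  lebesgueRV_succ0 lebesgueRV_succ_ge0 lebesgueRV_succ_sigma_additive.

Let lebesgueRV_succ_sigma_finite : sigma_finite setT lebesgueRV_succ.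
Proof.
have /sigma_finiteP[F [FT ndF Foo]] := sigma_finiteT (@lebesgue_measure R).
have /sigma_finiteP[G [GT ndG Goo]] := sigma_finiteT m.
exists (fun k => @unconsRV n @^-1` (F k `*` G k)).
  apply/seteqP; split => // v _.
  have [i _ Fi] : (\bigcup_k F k) (unconsRV v).1 by rewrite -FT.
  have [j _ Gj] : (\bigcup_k G k) (unconsRV v).2 by rewrite -GT.
  exists (maxn i j) => //; split.
  - by move: Fi; exact/subsetPset/ndF/leq_maxl.
  - by move: Gj; exact/subsetPset/ndG/leq_maxr.
move=> k; have [mF Fk] := Foo k; have [mG Gk] := Goo k; split.
  rewrite -[X in measurable X]setTI; apply: measurable_unconsRV => //.
  exact: measurableX.
rewrite /lebesgueRV_succ /pushforward -comp_preimage.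
rewrite (_ : _ \o _ = id); last by apply/funext => p; exact: consRVK.
by rewrite preimage_id product_measure1E// lte_mul_pinfty// ge0_fin_numE.
Qed.

HB.instance Definition _ := Measure_isSigmaFinite.Build _ _ _
  lebesgueRV_succ lebesgueRV_succ_sigma_finite.

End succ.

(* Lebesgue measure on R^d: the d-fold product of the Lebesgue measure on R
   (the unit mass on R^0), transported to row vectors. *)
Fixpoint lebesgueRV (d : nat) : {sigma_finite_measure set (borelRV R d) -> \bar R} :=
  match d with
  | 0 => @dirac _ (borelRV R 0) (0%R : 'rV[R]_0) R
  | n.+1 => lebesgueRV_succ (lebesgueRV n)
  end.

Lemma lebesgueRV_box d (A : 'I_d -> set (measurableTypeR R)) :
  (forall i, measurable (A i)) ->
  lebesgueRV d [set v | forall i, A i (v ord0 i)] =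
  \prod_(i < d) @lebesgue_measure R (A i).
Proof.
elim: d A => [|d IH] A mA /=.
  rewrite big_ord0 diracE mem_set// => -[].
  by [].
rewrite /lebesgueRV_succ /pushforward big_ord_recl -IH//.
rewrite -product_measure1E//; last first.
  rewrite [X in measurable X](_ : _ = \bigcap_(i : 'I_d)
    ((fun v : borelRV R d => v ord0 i : measurableTypeR R) @^-1` A (lift ord0 i))).
    by apply: fin_bigcap_measurable => // i _; rewrite -[X in measurable X]setTI;
       exact: measurable_coordRV.
  by apply/seteqP; split => [v vA i _|v vA i]; [exact: vA|exact: (vA i)].
congr product_measure1; apply/seteqP; split => [p pA|p [p0 pS] i] /=.
  split; first by have := pA ord0; rewrite consRV0.
  by move=> i; have := pA (lift ord0 i); rewrite consRVS.
by case: (unliftP ord0 i) => [k ->|->]; rewrite ?consRVS ?consRV0.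
Qed.

End lebesgueRV.

(* Norm balls of ['rV[R]_d] in the library are cubes, hence this definition. *)
Definition euclidean_ball (R : realType) (d : nat) (x : 'rV[R]_d) (r : R) :
    set (borelRV R d) :=
  [set y | Num.sqrt (\sum_(i < d) (y ord0 i - x ord0 i) ^+ 2) < r].

(* The total variation measure |nu| = nu^+ + nu^- of a finite signed measure;
   it does not depend on the selected Hahn decomposition. *)
Definition total_variation d (T : measurableType d) (R : realType)
    (nu : {charge set T -> \bar R}) : set T -> \bar R :=
  let P := cid (Hahn_decomposition nu) in
  let N := cid (projT2 P) in
  charge_variation (projT2 N).

Section maximal_function.
Local Open Scope ereal_scope.
Context (R : realType) (d : nat) (mu : {charge set (borelRV R d) -> \bar R}).

Definition maximal_function (x : 'rV[R]_d) : \bar R :=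
  ereal_sup [set total_variation mu (euclidean_ball x r)
                 / lebesgueRV R d (euclidean_ball x r)
            | r in [set r : R | (0 < r)%R]].

End maximal_function.

(* Main.v *)
(** Let [m = |mu|], let [L] be the Lebesgue measure and let [O_t] be the union
    of the sup-norm balls [B], with rational centre and radius, such that
    [m B > t * L B]. Up to a dilation of [t] by a dimensional constant, the
    open sets [O_t] are interlaced with the superlevel sets of the maximal
    function. A Vitali covering argument gives the weak-type bound
    [t * L O_t <= 3^d * m O_t], hence [L O_t -> 0], and if [m << L] then
    [m O_t -> 0] as well.
    Conversely, cover an open set [W] containing [O_t] by the balls [B]
    contained in [W] such that [3B] meets the complement of [O_t]: these
    satisfy [m (3B) <= t * L (3B)], and the same covering argument gives
    [m W <= 3^d * t * L W]. Taking for [W] the union of [O_t] and a small open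
    neighbourhood of a Lebesgue-null set [N] yields
    [m N <= 3^d * t * L O_t], which tends to [0]. *)

Require Import Defs.
From mathcomp Require Import all_boot all_order all_algebra.
From mathcomp Require Import all_classical all_reals all_analysis.
From mathcomp Require Import measurable_realfun ring lra.

Set Implicit Arguments.
Unset Strict Implicit.
Unset Printing Implicit Defensive.

Import Order.TTheory GRing.Theory Num.Theory.
Import numFieldNormedType.Exports.

Local Open Scope classical_set_scope.
Local Open Scope ring_scope.

(** * Vitali covering: finite families, then a comparison of two measures *)

(** Greedy choice: keep a ball of largest radius, discard the balls that meet it, all contained in
    its triple, and recurse on the rest. *)
Lemma vitali_finite (R : realType) (T : pseudoMetricType R) (I : choiceType)
    (c : I -> T) (r : I -> R) (s : seq I) :
  {in s, forall i, 0 < r i} ->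
  exists D : seq I, [/\ uniq D, {subset D <= s},
    trivIset [set` D] (fun i => ball (c i) (r i)) &
    {in s, forall i, exists2 j, j \in D &
      ball (c i) (r i) `<=` ball (c j) (3 * r j)}].
Proof.
have [n] := ubnP (size s); elim: n s => // n IH s sn r0.
have [->|s0] := eqVneq s [::]; first by exists [::]; split => // i j; rewrite inE.
have [j js jmax] : exists2 j, j \in s & {in s, forall i, r i <= r j}.
  elim: s s0 {sn r0} => // i s IHs _.
  have [->|/IHs[j js jmax]] := eqVneq s [::].
    by exists i; [exact: mem_head|move=> k; rewrite inE => /eqP ->].
  have [ij|ji] := leP (r i) (r j).
    exists j; first by rewrite inE js orbT.
    by move=> k /[!inE] /orP[/eqP ->//|/jmax].
  exists i; first exact: mem_head.
  by move=> k /[!inE] /orP[/eqP ->//|/jmax /le_trans]; apply; exact: ltW.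
pose meets i := `[< ball (c i) (r i) `&` ball (c j) (r j) !=set0 >].
have cj : ball (c j) (r j) (c j) by exact/ballxx/r0.
pose t := [seq i <- s | ~~ meets i].
have ts : {subset t <= s} by move=> i; rewrite mem_filter => /andP[].
have tn : (size t < n)%N.
  rewrite -ltnS (leq_trans _ sn)// !ltnS size_filter -(count_predC meets s) addnC.
  rewrite -[ltnLHS]addn0 ltn_add2l -has_count; apply/hasP.
  by exists j => //; apply/asboolP; exists (c j).
have [D [uD Dt tD Dcov]] := IH t tn (fun i => fun it => r0 i (ts i it)).
have Dj i : i \in D -> ball (c i) (r i) `&` ball (c j) (r j) = set0.
  move=> /Dt; rewrite mem_filter => /andP[/asboolPn + _].
  by move=> /set0P /negP/negPn/eqP.
exists (j :: D); split.
- rewrite /= uD andbT; apply/negP => /Dj /seteqP[+ _].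
  by move=> /(_ (c j)); apply.
- by move=> i /[!inE] /orP[/eqP ->|/Dt /ts].
- move=> i k /=; rewrite !inE => /orP[/eqP ->|iD] /orP[/eqP ->|kD] //.
  + by rewrite setIC Dj// => -[].
  + by rewrite Dj// => -[].
  + exact: tD.
- move=> i si; have [/asboolP[y [iy jy]]|mi] := boolP (meets i).
    exists j; first exact: mem_head.
    move=> x ix; have := jmax _ si => rij.
    apply: (@le_ball _ _ _ (r j + r i + r i)).
      by lra.
    by apply: ball_triangle ix; apply: ball_triangle jy (ball_sym iy).
  have [|k kD ik] := Dcov i; first by rewrite mem_filter mi.
  by exists k => //; rewrite inE kD orbT.
Qed.

(** Rational parameters make the family countable. *)
Definition ratball (R : realType) (d : nat) (k : R) (p : 'rV[rat]_d * rat) :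
    set (borelRV R d) :=
  ball (map_mx ratr p.1 : 'rV[R]_d) (k * ratr p.2).

Lemma open_measurableRV (R : realType) (d : nat) (U : set (borelRV R d)) :
  @open 'rV[R]_d U -> measurable U.
Proof. by move=> oU; exact: sub_sigma_algebra. Qed.

Lemma measurable_ballRV (R : realType) (d : nat) (x : 'rV[R]_d) (r : R) :
  measurable (ball x r : set (borelRV R d)).
Proof. by apply: open_measurableRV; exact: ball_open. Qed.

Lemma open_ratballs (R : realType) (d : nat) (I : set ('rV[rat]_d * rat)) :
  @open 'rV[R]_d (\bigcup_(p in I) ratball 1 p).
Proof. by apply: bigcup_open => p _; exact: ball_open. Qed.

(** For a finite subfamily, the triples of the selected balls cover the union, and disjointness
    bounds the sum of the [m2 B] by [m2] of the union. Continuity from below handles the whole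
    family. Lebesgue measure is used in either role. *)
Lemma vitali_measure_le (R : realType) (d : nat)
    (m1 m2 : {measure set (borelRV R d) -> \bar R})
    (I : set ('rV[rat]_d * rat)) (k : R) :
  0 <= k -> (forall p, I p -> 0 < p.2) ->
  (forall p, I p -> (m1 (ratball 3 p) <= k%:E * m2 (ratball 1 p))%E) ->
  (m1 (\bigcup_(p in I) ratball 1 p) <=
   k%:E * m2 (\bigcup_(p in I) ratball 1 p))%E.
Proof.
move=> k0 I0 Ile.
have mB l p : measurable (ratball l p) by exact: measurable_ballRV.
(* [s n] lists the indices in [I] of code less than [n], whence the witness [(pickle p).+1]
   below. *)
pose s n : seq ('rV[rat]_d * rat) := [seq p <- pmap unpickle (iota 0 n) | `[< I p >]].
have sI n p : p \in s n -> I p by rewrite mem_filter => /andP[/asboolP].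
pose U n : set (borelRV R d) := \bigcup_(p in [set` s n]) ratball 1 p.
have mU n : measurable (U n).
  by apply: fin_bigcup_measurable => // p _; exact: mB.
have UI : \bigcup_n U n = \bigcup_(p in I) ratball 1 p.
  apply/seteqP; split => [x [n _ [p /= /sI Ip px]]|x [p Ip px]]; first by exists p.
  exists (pickle p).+1 => //; exists p => //=; rewrite mem_filter.
  apply/andP; split; first exact/asboolP.
  rewrite mem_pmap; apply/mapP; exists (pickle p); last by rewrite pickleK.
  by rewrite mem_iota add0n leq0n ltnSn.
have ndU : nondecreasing_seq U.
  move=> n m nm; apply/subsetPset => x [p /= ps px]; exists p => //=; move: ps.
  rewrite !mem_filter => /andP[-> /=]; rewrite !mem_pmap.
  by rewrite -(subnKC nm) iotaD map_cat mem_cat => ->.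
have mUI : measurable (\bigcup_n U n) by exact: bigcup_measurable.
rewrite -UI; have := nondecreasing_cvg_mu (mu := m1) mU mUI ndU.
move=> /cvg_lim <-//; apply: lime_le.
  apply: ereal_nondecreasing_is_cvgn => n m nm; apply: le_measure; rewrite ?inE//.
  exact/subsetPset/ndU.
apply: nearW => n /=.
have [|D [uD Ds tD Dcov]] := @vitali_finite R _ _
    (fun p : 'rV[rat]_d * rat => map_mx ratr p.1 : 'rV[R]_d)
    (fun p => 1 * ratr p.2) (s n).
  by move=> p /sI /I0; rewrite mul1r ltr0q.
have mD l : measurable (\bigcup_(p in [set` D]) ratball l p).
  by apply: fin_bigcup_measurable.
apply: (@le_trans _ _ (\sum_(p \in [set` D]) m1 (ratball 3 p))%E).
  apply: content_sub_fsum => [|p _||x [p /= /Dcov[q qD pq] /pq qx]].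
  - exact: finite_seq.
  - exact: mB.
  - exact: mU.
  exists q; first exact: qD.
  by rewrite /ratball -[ratr q.2]mul1r.
apply: (@le_trans _ _ (\sum_(p \in [set` D]) k%:E * m2 (ratball 1 p))%E).
  rewrite -(fsbig_seq _ (fun p => m1 (ratball 3 p)) uD).
  rewrite -(fsbig_seq _ (fun p => k%:E * m2 (ratball 1 p))%E uD).
  by rewrite big_seq [leRHS]big_seq; apply: lee_sum => p /Ds /sI; exact: Ile.
rewrite -ge0_mule_fsumr; last by move=> p; exact: measure_ge0.
rewrite -measure_fin_bigcup// lee_wpmul2l// le_measure ?inE ?UI//.
  by rewrite -UI.
by move=> x [p /Ds/sI Ip px]; exists p.
Qed.

(** * Volume of cubes, comparison with Euclidean balls, outer regularity *)

Lemma lebesgueRV_ball (R : realType) (d : nat) (x : 'rV[R]_d) (r : R) :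
  0 < r -> lebesgueRV R d (ball x r) = ((2 * r) ^+ d)%:E.
Proof.
move=> r0.
rewrite (_ : ball x r = [set v : borelRV R d |
    forall i, `]x ord0 i - r, x ord0 i + r[%classic (v ord0 i)]); last first.
  apply/seteqP; split => v /=.
    move=> [_ xv] i; have := xv ord0 i.
    by rewrite -ball_normE /= in_itv/= ltr_distlC.
  move=> xv; split => // i j; rewrite ord1.
  by have := xv j; rewrite -ball_normE /= in_itv/= ltr_distlC.
rewrite (@lebesgueRV_box R d (fun i => `]x ord0 i - r, x ord0 i + r[%classic))//.
rewrite (eq_bigr (fun=> (2 * r)%:E)); last first.
  move=> i _; rewrite lebesgue_measure_itv/= lte_fin ltrD2l gtrN// -EFinD.
  by congr EFin; lra.
by rewrite big_const_ord; elim: d {x} => //= n ->; rewrite exprS EFinM.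
Qed.

(** The integral of a nonnegative function is a supremum over the simple functions below it, so it
    is monotone without measurability. *)
Lemma ge0_le_integral_nonmeasurable d (T : measurableType d) (R : realType)
    (m : {measure set T -> \bar R}) (f g : T -> \bar R) :
  (forall x, 0 <= f x)%E -> (forall x, f x <= g x)%E ->
  (\int[m]_x f x <= \int[m]_x g x)%E.
Proof.
move=> f0 fg; have g0 x : (0 <= g x)%E by exact: le_trans (fg x).
rewrite !ge0_integralTE//; apply: le_ereal_sup => _ [h hf <-].
by exists h => // x; exact: le_trans (hf x) (fg x).
Qed.

(* Monotonicity on arbitrary sets spares us the measurability of the superlevel
   sets of the maximal function: they only need to be squeezed between open
   sets. *)
Lemma le_lebesgueRV (R : realType) (d : nat) (A B : set (borelRV R d)) :
  A `<=` B -> (lebesgueRV R d A <= lebesgueRV R d B)%E.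
Proof.
elim: d A B => [|d IH] A B AB /=.
  rewrite !diracE lee_fin ler_nat; case: (boolP (_ \in A)) => // /set_mem /AB.
  by move=> /mem_set ->.
rewrite /lebesgueRV_succ /pushforward; apply: ge0_le_integral_nonmeasurable => x //=.
by apply: IH => y; rewrite /xsection /= !inE => /AB.
Qed.

Lemma measurable_euclidean_ball (R : realType) (d : nat) (x : 'rV[R]_d) (r : R) :
  measurable (euclidean_ball x r).
Proof.
pose f (y : borelRV R d) : measurableTypeR R := \sum_(i < d) (y ord0 i - x ord0 i) ^+ 2.
have mf : measurable_fun setT f.
  apply: measurable_sum => i; apply: measurable_funX.
  by apply: measurable_funB => //; exact: measurable_coordRV.
rewrite (_ : euclidean_ball x r = (Num.sqrt \o f) @^-1` `]-oo, r[%classic); last first.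
  by apply/seteqP; split => y; rewrite /= in_itv.
rewrite -[X in measurable X]setTI.
have : measurable_fun [set: borelRV R d] (Num.sqrt \o f : _ -> measurableTypeR R).
  apply: (measurableT_comp _ mf); apply: continuous_measurable_fun.
  exact: sqrt_continuous.
by apply.
Qed.

Lemma euclidean_ball_sub (R : realType) (d : nat) (x : 'rV[R]_d) (r : R) :
  0 < r -> euclidean_ball x r `<=` ball x r.
Proof.
move=> r0 y; rewrite /euclidean_ball /= => yr; split => // i j; rewrite ord1.
rewrite -ball_normE /= distrC; apply: le_lt_trans yr.
rewrite -sqrtr_sqr ler_wsqrtr// (bigD1 j)//= lerDl.
by apply: sumr_ge0 => k _; exact: sqr_ge0.
Qed.

(** The factor [d.+1], cruder than the square root of [d], avoids a division by zero when
    [d = 0]. *)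
Lemma sub_euclidean_ball (R : realType) (d : nat) (x : 'rV[R]_d) (r : R) :
  0 < r -> ball x (r / d.+1%:R) `<=` euclidean_ball x r.
Proof.
move=> r0 y [e0 xy]; rewrite /euclidean_ball /=.
rewrite -[ltRHS](gtr0_norm r0) -sqrtr_sqr ltr_sqrt ?exprn_gt0//.
apply: (@le_lt_trans _ _ (\sum_(i < d) (r / d.+1%:R) ^+ 2)).
  apply: ler_sum => i _; have := xy ord0 i; rewrite -ball_normE /= distrC => /ltW ylt.
  by rewrite -real_normK ?num_real// lerXn2r// nnegrE ?ltW.
rewrite sumr_const card_ord -[X in _ < X ^+ 2](divfK (x := d.+1%:R)) ?pnatr_eq0//.
rewrite [ltRHS]exprMn -[ltLHS]mulr_natr ltr_pM2l ?exprn_gt0 ?divr_gt0// -natrX ltr_nat.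
by rewrite expnS expn1 (leq_trans (ltnSn d))// leq_pmulr.
Qed.

(* Stating outer regularity for [A] and [~` A] at once makes the property
   stable under complement, so that it defines a sigma-algebra. *)
Lemma borelRV_regular (R : realType) (d : nat)
    (m : {measure set (borelRV R d) -> \bar R}) (A : set (borelRV R d)) :
  (m setT < +oo)%E -> measurable A -> forall e : R, 0 < e ->
  exists U V : set 'rV[R]_d, [/\ open U, open V, A `<=` U, ~` A `<=` V &
    (m (U `&` V) < e%:E)%E].
Proof.
move=> moo; pose G (A : set (borelRV R d)) := forall e : R, 0 < e ->
  exists U V : set 'rV[R]_d, [/\ open U, open V, A `<=` U, ~` A `<=` V &
    (m (U `&` V) < e%:E)%E].
have mfin B : measurable B -> (m B < +oo)%E.
  by move=> mB; apply: le_lt_trans moo; apply: le_measure; rewrite ?inE.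
(* Continuity from above, which relies on the finiteness of [m]. *)
have small (B : nat -> set (borelRV R d)) (e : R) : 
    (forall n, @open 'rV[R]_d (B n)) ->
    (forall n p, (n <= p)%N -> (B p <= B n)%O) ->
    (m (\bigcap_n B n) < e%:E)%E -> exists n, (m (B n) < e%:E)%E.
  move=> oB ndB mBe; have mB n : measurable (B n) by exact: open_measurableRV.
  have mcapB : measurable (\bigcap_n B n) by exact: bigcap_measurable.
  apply: contrapT => /forallNP nB; move: mBe; apply/negP; rewrite -leNgt.
  have cvB := nonincreasing_cvg_mu (mu := m) (mfin _ (mB 0%N)) mB mcapB ndB.
  rewrite -(cvg_lim _ cvB)//; apply: lime_ge; first by apply/cvg_ex; eexists; exact: cvB.
  by apply: nearW => n; rewrite leNgt; apply/negP/nB.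
suff : <<s [set U : set 'rV[R]_d | open U] >> `<=` G by exact.
apply: smallest_sub; first split.
- move=> e e0; exists set0, setT; split => //; first exact: openT.
  by rewrite set0I measure0 lte_fin.
- move=> B GB e /GB[U [V [oU oV BU BV mUV]]].
  exists V, U; split => //; first by rewrite setTD.
    by rewrite setTD setCK.
  by rewrite setIC.
(* Countable union: the intersection of all the [V i] need not be open, so only the first [n] are
   kept, with [n] supplied by [small]. Halving [e] leaves room for the strict inequality. *)
- move=> F GF e e0.
  have /choice[U /choice[V UV]] : forall n, exists U, exists V : set 'rV[R]_d,
      [/\ open U, open V, F n `<=` U, ~` F n `<=` V &
        (m (U `&` V) < (e / 2 / (2 ^ n.+1)%:R)%:E)%E].
    by move=> n; apply: GF; rewrite !divr_gt0// ltr0n expn_gt0.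
  have oU : @open 'rV[R]_d (\bigcup_n U n).
    by apply: bigcup_open => n _; have [] := UV n.
  have mUV n : measurable (U n `&` V n : set (borelRV R d)).
    by apply: open_measurableRV; have [? ? _ _ _] := UV n; exact: openI.
  pose W n := \bigcap_(i in `I_n) V i.
  have oW n : @open 'rV[R]_d (W n).
    rewrite /W bigcap_mkord; apply: big_ind => [|B C oB oC|i _]; first exact: openT.
      exact: openI.
    by have [_ ? _ _ _] := UV i.
  have [|||n mn] := small (fun n => \bigcup_n U n `&` W n) e.
  + by move=> n; exact: openI.
  + move=> n p np; apply/subsetPset; apply: setIS => x Wx i /= ni.
    by apply: Wx => /=; exact: leq_trans np.
  + apply: (@le_lt_trans _ _ (m (\bigcup_n (U n `&` V n)))).
      apply: le_measure; rewrite ?inE.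
      * by apply: bigcap_measurable => // n _; apply: open_measurableRV; exact: openI.
      * exact: bigcup_measurable.
      * move=> x xUW; have [[i _ Ui] _] := xUW 0%N I.
        exists i => //; split => //; have [_] := xUW i.+1 I; apply => /=.
        exact: ltnSn.
    apply: le_lt_trans (generalized_Boole_inequality _ _ _) _.
    * exact: mUV.
    * exact: bigcup_measurable.
    apply: (@le_lt_trans _ _ (e / 2)%:E); last first.
      by rewrite lte_fin gtr_pMr ?invf_lt1 ?ltr1n.
    apply: le_trans (epsilon_trick0 xpredT (ltW _)); last by rewrite divr_gt0.
    apply: lee_nneseries => n _ //; apply: ltW.
    by have [] := UV n.
  exists (\bigcup_n U n), (W n); split => //.
    by move=> x [i _ Fx]; exists i => //; have [_ _ + _ _] := UV i; exact.
  move=> x Fx i _; have [_ _ _ + _] := UV i; apply => Fi.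
  by apply: Fx; exists i.
(* Open set: the thickenings of the complement by [n.+1%:R^-1] shrink to the complement, so their
   traces on [U] have empty intersection. *)
- move=> U oU e e0.
  pose V n : set 'rV[R]_d := \bigcup_(y in ~` U) ball y (n.+1%:R^-1).
  have oV n : open (V n) by apply: bigcup_open => y _; exact: ball_open.
  have [|||n mn] := small (fun n => U `&` V n) e.
  + by move=> n; exact: openI.
  + move=> n p np; apply/subsetPset; apply: setIS => x [y Uy yx].
    exists y => //; apply: le_ball yx.
    by rewrite lef_pV2 ?posrE// ler_nat.
  + rewrite (_ : \bigcap_n _ = set0) ?measure0 ?lte_fin//.
    rewrite -subset0 => x xUV; have [Ux _] := xUV 0%N I.
    have /nbhs_ballP[r /= r0 xrU] := open_nbhs_nbhs (conj oU Ux).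
    have [_ [y Uy yx]] := xUV (Num.truncn r^-1) I.
    apply: Uy; apply: xrU; apply: ball_sym; apply: le_ball yx.
    by rewrite invf_ple ?posrE// ltW// truncnS_gt.
  exists U, (V n); split => // x Ux; exists x => //; exact: ballxx.
Qed.

(** Since [borelRV_regular] requires a finite measure, it is applied to [lebesgueRV] restricted to
    each ball [W n], and the resulting open sets are glued with errors [e / 2 ^ n.+1]. *)
Lemma lebesgueRV_null_open (R : realType) (d : nat) (A : set (borelRV R d)) :
  measurable A -> lebesgueRV R d A = 0%E -> forall e : R, 0 < e ->
  exists U : set 'rV[R]_d, [/\ open U, A `<=` U & (lebesgueRV R d U <= e%:E)%E].
Proof.
move=> mA A0 e e0; pose W n : set (borelRV R d) := ball (0 : 'rV[R]_d) n.+1%:R.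
have mW n : measurable (W n) by exact: measurable_ballRV.
have /choice[U UP] : forall n, exists U : set 'rV[R]_d, [/\ open U, A `<=` U &
    (lebesgueRV R d (U `&` W n) <= (e / (2 ^ n.+1)%:R)%:E)%E].
  move=> n.
  have moo : (mrestr (lebesgueRV R d) (mW n) setT < +oo)%E.
    by rewrite /mrestr setTI lebesgueRV_ball// ltry.
  have e'0 : 0 < e / (2 ^ n.+1)%:R by rewrite divr_gt0// ltr0n expn_gt0.
  have [U [V [oU oV AU AV UVe]]] := @borelRV_regular R d
    (mrestr (lebesgueRV R d) (mW n)) A moo mA _ e'0.
  exists U; split => //; apply: le_trans (ltW UVe).
  have mU := open_measurableRV oU; have mV := open_measurableRV oV.
  (* Outside the null set [A], all points of [U] lie in [V]. *)
  apply: (@le_trans _ _ (lebesgueRV R d (A `|` (U `&` V `&` W n)))).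
    apply: le_lebesgueRV => x [Ux Wx].
    by have [Ax|/AV Vx] := pselect (A x); [left|right].
  apply: le_trans (measureU2 _ _ _) _ => //.
    by apply: measurableI => //; exact: measurableI.
  by rewrite [X in (X + _)%E](_ : _ = 0%E) ?add0e.
exists (\bigcup_n (U n `&` W n)); split.
- by apply: bigcup_open => n _; apply: openI; [have [] := UP n|exact: ball_open].
- move=> x Ax; exists (Num.truncn `|x|) => //; split.
    by have [_ + _] := UP (Num.truncn `|x|); exact.
  by rewrite /W -ball_normE /= sub0r normrN truncnS_gt.
have mUW n : measurable (U n `&` W n : set (borelRV R d)).
  by apply: measurableI => //; apply: open_measurableRV; have [] := UP n.
apply: le_trans (generalized_Boole_inequality _ _ _) _ => //.
  exact: bigcup_measurable.
apply: le_trans (epsilon_trick0 xpredT (ltW e0)).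
by apply: lee_nneseries => n _ //; have [] := UP n.
Qed.

Lemma subset_ball (R : realType) (d : nat) (x y : 'rV[R]_d) (r s t : R) :
  ball x r y -> r + s <= t -> ball y s `<=` ball x t.
Proof. by move=> xy rst z yz; apply: le_ball rst _ _; exact: ball_triangle xy yz. Qed.

Lemma lebesgueRV_ratball (R : realType) (d : nat) (k : R) (p : 'rV[rat]_d * rat) :
  0 < k -> 0 < p.2 ->
  lebesgueRV R d (ratball k p) = ((k ^+ d)%:E * lebesgueRV R d (ratball 1 p))%E.
Proof.
move=> k0 p0; have rp0 : 0 < ratr p.2 :> R by rewrite ltr0q.
have krp : 0 < k * ratr p.2 :> R by exact: mulr_gt0.
rewrite /ratball mul1r !lebesgueRV_ball -?EFinM -?exprMn//.
by congr (_ ^+ _)%:E; rewrite mulrCA.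
Qed.

Lemma ratball_dense (R : realType) (d : nat) (x : 'rV[R]_d) (r s : R) :
  0 < r -> r < s -> exists p : 'rV[rat]_d * rat,
    [/\ 0 < p.2, ball x r `<=` ratball 1 p & ratball 1 p `<=` ball x s].
Proof.
(* The centre is taken within [e] of [x] and the radius between [r + e] and [r + 2 * e], so the
   outer inclusion only needs [r + 3 * e < s]. *)
move=> r0 rs; pose e := (s - r) / 4; have e0 : 0 < e by rewrite divr_gt0// subr_gt0.
have /choice[c cE] : forall i : 'I_d, exists q : rat, ball (x ord0 i) e (ratr q).
  move=> i; have [||y [xq [q _ qy]]] := @dense_rat R (ball (x ord0 i) e).
  - by exists (x ord0 i); exact: ballxx.
  - exact: ball_open.
  by exists q; rewrite qy.
have xc : ball x e (map_mx ratr (\row_i c i) : 'rV[R]_d).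
  by split => // i j; rewrite !mxE ord1.
have [||t [/= + [q _ qt]]] := @dense_rat R `]r + e, r + 2 * e[%classic.
- by exists (r + 3 / 2 * e); rewrite /= in_itv/=; apply/andP; split; lra.
- exact: interval_open.
rewrite in_itv/= -qt => /andP[rq qe].
exists (\row_i c i, q); split => /=.
- by rewrite -(ltr0q R); lra.
- by apply: subset_ball (ball_sym xc) _; rewrite mul1r; lra.
- by apply: subset_ball xc _; rewrite mul1r /e in qe *; lra.
Qed.

(** * Covering estimates for the sets O_t *)

Section superlevel.
Context (R : realType) (d : nat) (m : {measure set (borelRV R d) -> \bar R}).
Context (moo : (m setT < +oo)%E).
Local Notation L := (lebesgueRV R d).

Definition heavy (lambda : R) : set ('rV[rat]_d * rat) :=
  [set p | 0 < p.2 /\ (lambda%:E * L (ratball 1 p) < m (ratball 1 p))%E].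

(** This is O_t for [t = lambda]. *)
Definition ratlevel (lambda : R) : set (borelRV R d) :=
  \bigcup_(p in heavy lambda) ratball 1 p.

Lemma open_ratlevel (lambda : R) : @open 'rV[R]_d (ratlevel lambda).
Proof. exact: open_ratballs. Qed.

Lemma measurable_ratlevel (lambda : R) : measurable (ratlevel lambda).
Proof. by apply: open_measurableRV; exact: open_ratlevel. Qed.

(** A heavy ball satisfies L(3B) = 3^d L(B) <= (3^d / lambda) m(B). Having [m (ratlevel lambda)] on
    the right, not the total mass, is what yields the limit 0 in [superlevel_cvg0]. *)
Lemma ratlevel_weak_type (lambda : R) : 0 < lambda ->
  (L (ratlevel lambda) <= (3 ^+ d / lambda)%:E * m (ratlevel lambda))%E.
Proof.
move=> l0; apply: (vitali_measure_le (m1 := L)).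
- by rewrite divr_ge0// ltW.
- by move=> p [].
move=> p [p0 pl].
rewrite [leLHS](_ : _ = ((3 ^+ d)%:E * L (ratball 1 p))%E); last first.
  exact: lebesgueRV_ratball.
rewrite EFinM -muleA lee_wpmul2l//.
by rewrite muleC lee_pdivlMr// muleC ltW.
Qed.

Lemma ratlevel_fin_num (lambda : R) : 0 < lambda -> L (ratlevel lambda) \is a fin_num.
Proof.
move=> l0; rewrite ge0_fin_numE//; apply: le_lt_trans (ratlevel_weak_type l0) _.
rewrite lte_mul_pinfty//; first by rewrite lee_fin divr_ge0// ltW.
by apply: le_lt_trans moo; apply: le_measure; rewrite ?inE//; exact: measurable_ratlevel.
Qed.

(** The balls of [I] have triples that are not heavy, and they cover the union because volumes of
    growing balls are unbounded; this fails in dimension 0. *)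
Lemma ratlevel_upper (lambda : R) (V : set 'rV[R]_d) :
  (0 < d)%N -> 0 < lambda -> open V ->
  (m (V `|` ratlevel lambda) <=
   (3 ^+ d * lambda)%:E * L (V `|` ratlevel lambda))%E.
Proof.
move=> d0 l0 oV; set O := ratlevel lambda.
have oW : @open 'rV[R]_d (V `|` O) by apply: openU => //; exact: open_ratlevel.
pose I : set ('rV[rat]_d * rat) := [set p | [/\ 0 < p.2,
  ratball 1 p `<=` V `|` O & exists2 y : 'rV[R]_d, ratball 3 p y & ~ O y]].
have ratball3 p : ratball 3 p = ratball 1 (p.1, 3 * p.2) :> set (borelRV R d).
  by rewrite /ratball /= mul1r rmorphM /= ratr_nat.
have -> : V `|` O = \bigcup_(p in I) ratball 1 p.
  apply/seteqP; split => [x Wx|x [p [_ + _] px]]; last exact.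
  have /nbhs_ballP[e /= e0 xeW] := open_nbhs_nbhs (conj oW Wx).
  have [||[q s] [/= s0 xp pW]] := @ratball_dense R d x (e / 2) e.
  - by rewrite divr_gt0.
  - by rewrite gtr_pMr// invf_lt1// ltr1n.
  apply: contrapT => nI.
  (* If no ball of [I] contained [x], tripling a ball around [x] would keep it
     in [O] forever, contradicting [L O < +oo]. *)
  have step t : s <= t -> ratball 1 (q, t) `<=` V `|` O -> ratball 1 (q, 3 * t) `<=` O.
    move=> st tW y; rewrite -(ratball3 (q, t)) => ty; apply: contrapT => Oy.
    apply: nI; exists (q, t).
      split => //; first exact: lt_le_trans st.
      exists y; first exact: ty.
      exact: Oy.
    have xs : ratball 1 (q, s) x by apply: xp; apply: ballxx; rewrite divr_gt0.
    by apply: le_ball xs; rewrite !mul1r ler_rat.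
  have grow n : ratball 1 (q, 3 ^+ n.+1 * s) `<=` O.
    elim: n => [|n IH]; first by rewrite expr1; apply: step (subset_trans pW xeW).
    rewrite exprS -mulrA; apply: step; last by apply: subset_trans IH _; right.
    by rewrite ler_pMl// exprn_ege1// ler1n.
  (* The lower bound 1 on [a] ensures that a side length above [a] is at most its [d]-th power, so
     the volume of the cube exceeds [L O]. *)
  pose a := Num.max 1 (fine (L O)); pose n := Num.truncn (a / ratr s).
  have rs0 : 0 < ratr s :> R by rewrite ltr0q.
  have := le_lebesgueRV (grow n); rewrite -/L leNgt => /negP; apply.
  rewrite /ratball mul1r lebesgueRV_ball/=; last by rewrite ltr0q mulr_gt0// exprn_gt0.
  rewrite -(fineK (ratlevel_fin_num l0)) lte_fin rmorphM rmorphXn /= ratr_nat.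
  have an : a < 2 * (3 ^+ n.+1 * ratr s).
    have : a < n.+1%:R * ratr s by rewrite -ltr_pdivrMr// truncnS_gt.
    move=> /lt_le_trans; apply; rewrite mulrA ler_pM2r//.
    rewrite -natrX -natrM ler_nat (leq_trans (ltnW (ltn_expl n.+1 (isT : 1 < 3)%N)))//.
    by rewrite leq_pmull.
  have [a1 aO] : 1 <= a /\ fine (L O) <= a by rewrite !le_max !lexx orbT.
  apply: le_lt_trans aO (lt_le_trans an _).
  by rewrite -[leLHS]expr1 ler_weXn2l// (le_trans a1)// ltW.
apply: vitali_measure_le.
- by rewrite mulr_ge0// ltW.
- by move=> p [].
move=> p [p0 pW [y py Oy]].
rewrite [leRHS](_ : _ = lambda%:E * L (ratball 3 p))%E; last first.
  by rewrite lebesgueRV_ratball// mulrC EFinM muleA.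
(* Otherwise the triple, itself a rational ball, would be heavy and put [y] in [O]. *)
rewrite leNgt; apply/negP => hp; apply: Oy; exists (p.1, 3 * p.2).
  by split; [rewrite mulr_gt0|rewrite -ratball3].
by rewrite -ratball3.
Qed.

Lemma ratlevel_null (lambda : R) (N : set (borelRV R d)) :
  (0 < d)%N -> 0 < lambda -> measurable N -> L N = 0%E ->
  (m N <= (3 ^+ d * lambda)%:E * L (ratlevel lambda))%E.
Proof.
move=> d0 l0 mN N0; set k := 3 ^+ d * lambda.
have k0 : 0 < k by rewrite mulr_gt0// exprn_gt0.
apply/lee_addgt0Pr => e e0.
have [|V [oV NV Ve]] := @lebesgueRV_null_open R d N mN N0 (e / k).
  by rewrite divr_gt0.
have mV := open_measurableRV oV; have mO := measurable_ratlevel lambda.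
apply: (@le_trans _ _ (m (V `|` ratlevel lambda))).
  apply: le_measure; rewrite ?inE//; first exact: measurableU.
  by move=> x /NV; left.
apply: le_trans (ratlevel_upper d0 l0 oV) _; rewrite -/k.
apply: (@le_trans _ _ (k%:E * ((e / k)%:E + L (ratlevel lambda))))%E.
  apply: lee_wpmul2l; first by rewrite lee_fin ltW.
  apply: le_trans (measureU2 _ _ _) _ => //.
  by rewrite leeD2r.
rewrite ge0_muleDr//; last by rewrite lee_fin divr_ge0// ltW.
by rewrite -EFinM mulrCA divff ?gt_eqF// mulr1 addeC.
Qed.

End superlevel.

(** * Comparison of O_t with the superlevel sets of the maximal function *)

(** Convertible to [total_variation], with a measure structure attached. *)
Definition variation_measure d (T : measurableType d) (R : realType)
    (nu : {charge set T -> \bar R}) : {measure set T -> \bar R} :=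
  charge_variation (projT2 (cid (projT2 (cid (Hahn_decomposition nu))))).

Section sandwich.
Context (R : realType) (d : nat) (mu : {charge set (borelRV R d) -> \bar R}).
Local Notation L := (lebesgueRV R d).
Local Notation m := (variation_measure mu).

Definition superlevel (lambda : R) : set (borelRV R d) :=
  [set x | (lambda%:E < maximal_function mu x)%E].

Lemma variation_measure_fin : (m setT < +oo)%E.
Proof.
rewrite -ge0_fin_numE//.
pose N := cid (projT2 (cid (Hahn_decomposition mu))).
exact: (fin_num_measure (charge_variation (projT2 N) : {charge set _ -> \bar R})).
Qed.

Lemma lebesgue_euclidean_ball_gt0 (x : 'rV[R]_d) (r : R) : 0 < r ->
  exists2 l : R, 0 < l & L (euclidean_ball x r) = l%:E.
Proof.
move=> r0.
have Lfin : L (euclidean_ball x r) \is a fin_num.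
  rewrite ge0_fin_numE//.
  apply: le_lt_trans (le_lebesgueRV (euclidean_ball_sub _)) _ => //.
  by rewrite lebesgueRV_ball// ltry.
exists (fine (L (euclidean_ball x r))); last by rewrite fineK.
rewrite -lte_fin fineK//; apply: lt_le_trans (le_lebesgueRV (sub_euclidean_ball _)) => //.
by rewrite lebesgueRV_ball ?divr_gt0// lte_fin exprn_gt0// mulr_gt0// divr_gt0.
Qed.

(** A supremum exceeds [lambda] exactly when one of the quotients does, and the denominators are
    positive reals. *)
Lemma superlevelP (lambda : R) (x : 'rV[R]_d) : superlevel lambda x <->
  exists2 r : R, 0 < r &
    (lambda%:E * L (euclidean_ball x r) < m (euclidean_ball x r))%E.
Proof.
split=> [/ereal_sup_gt[_ [r /= r0 <-]]|[r r0]].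
  have [l l0 Ll] := lebesgue_euclidean_ball_gt0 x r0.
  rewrite Ll inver gt_eqF// lte_pdivlMr// => lm; exists r => //.
  by rewrite Ll.
have [l l0 Ll] := lebesgue_euclidean_ball_gt0 x r0.
rewrite Ll -lte_pdivlMr// => lm; apply: lt_le_trans lm _.
apply: ereal_sup_ubound; exists r => //.
by rewrite Ll inver gt_eqF.
Qed.

(* Comparing sup-norm balls with Euclidean balls costs a factor [d.+1] on the
   radius, and passing to a rational ball or moving the centre to another point
   of the ball a factor [2]. *)
Definition dilation_const : R := (2 * d.+1%:R) ^+ d.

Lemma dilation_const_gt0 : 0 < dilation_const.
Proof. by rewrite exprn_gt0// mulr_gt0. Qed.

(** A rational ball is inserted between [ball x r] and [ball x (2 * r)]; the volume of the latter is
    [dilation_const] times that of a cube inside the Euclidean ball. *)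
Lemma superlevel_sub_ratlevel (lambda : R) : 0 < lambda ->
  superlevel (dilation_const * lambda) `<=` ratlevel m lambda.
Proof.
move=> l0 x /superlevelP[r r0 xl].
have [|p [p0 xp px]] := @ratball_dense R d x r (2 * r) r0; first by lra.
exists p; last by apply: xp; exact: ballxx.
split => //.
apply: (@le_lt_trans _ _ ((dilation_const * lambda)%:E * L (ball x (r / d.+1%:R)))%E).
  apply: (@le_trans _ _ (lambda%:E * L (ball x (2 * r)))%E).
    by apply: lee_wpmul2l; [rewrite lee_fin ltW|exact: le_lebesgueRV].
  rewrite !lebesgueRV_ball ?divr_gt0 ?mulr_gt0// -!EFinM lee_fin /dilation_const.
  rewrite (_ : 2 * (2 * r) = (2 * d.+1%:R) * (2 * (r / d.+1%:R))); last first.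
    by rewrite mulrACA [_ * (r / _)]mulrC divfK ?pnatr_eq0// mulrA.
  by rewrite exprMn mulrCA mulrA.
apply: (@le_lt_trans _ _ ((dilation_const * lambda)%:E * L (euclidean_ball x r))%E).
  apply: lee_wpmul2l; first by rewrite lee_fin mulr_ge0// ltW// dilation_const_gt0.
  by apply: le_lebesgueRV; exact: sub_euclidean_ball.
apply: lt_le_trans xl _; apply: le_measure; rewrite ?inE//.
- exact: measurable_euclidean_ball.
- exact: measurable_ballRV.
- exact: subset_trans (euclidean_ball_sub r0) xp.
Qed.

(** A rational ball of radius s containing [y] lies in the sup-norm ball of radius 2s at [y], hence
    in the Euclidean ball of radius 2s(d+1). *)
Lemma ratlevel_sub_superlevel (lambda : R) : 0 < lambda ->
  ratlevel m (dilation_const * lambda) `<=` superlevel lambda.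
Proof.
move=> l0 y [p [p0 pl] py].
have s0 : 0 < ratr p.2 :> R by rewrite ltr0q.
pose r : R := 2 * ratr p.2; have r0 : 0 < r by rewrite mulr_gt0.
have Kr0 : 0 < r * d.+1%:R by rewrite mulr_gt0.
apply/superlevelP; exists (r * d.+1%:R) => //.
apply: (@le_lt_trans _ _ (lambda%:E * L (ball y (r * d.+1%:R)))%E).
  apply: lee_wpmul2l; first by rewrite lee_fin ltW.
  by apply: le_lebesgueRV; exact: euclidean_ball_sub.
apply: (@le_lt_trans _ _ ((dilation_const * lambda)%:E * L (ratball 1 p))%E).
  rewrite /ratball !lebesgueRV_ball ?mul1r//.
  rewrite -!EFinM lee_fin /dilation_const /r.
  rewrite (_ : 2 * (2 * ratr p.2 * d.+1%:R) = (2 * d.+1%:R) * (2 * ratr p.2));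
    last by ring.
  by rewrite exprMn mulrCA mulrA.
apply: lt_le_trans pl _; apply: le_measure; rewrite ?inE//.
- exact: measurable_ballRV.
- exact: measurable_euclidean_ball.
- apply: (subset_trans _ (sub_euclidean_ball Kr0)); rewrite mulfK ?pnatr_eq0//.
  by apply: subset_ball (ball_sym py) _; rewrite mul1r /r; lra.
Qed.

End sandwich.

(** * The two implications *)

Lemma superlevel_cvg0 (R : realType) (d : nat)
    (mu : {charge set (borelRV R d) -> \bar R}) :
  mu `<< lebesgueRV R d ->
  (lambda%:E * lebesgueRV R d (superlevel mu lambda))%E @[lambda --> +oo%R] --> 0%E.
Proof.
move=> muL; set L := lebesgueRV R d; pose m := variation_measure mu.
set A := dilation_const R d; have A0 : 0 < A by exact: dilation_const_gt0.
pose k : R := A * 3 ^+ d; have k0 : 0 < k by rewrite mulr_gt0.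
have moo : (m setT < +oo)%E := variation_measure_fin mu.
pose M := fine (m setT).
have mM B : measurable B -> (m B <= M%:E)%E.
  move=> mB; rewrite /M fineK ?ge0_fin_numE//.
  by apply: le_measure; rewrite ?inE.
have M0 : 0 <= M by exact: fine_ge0.
have small e : 0 < e ->
    \forall lambda \near +oo%R, (lambda%:E * L (superlevel mu lambda) <= e%:E)%E.
  move=> e0; have [|r [r0 mr]] := charge_variation_continuous
    (projT2 (cid (projT2 (cid (Hahn_decomposition mu))))) muL (e := e / k).
    by rewrite divr_gt0.
  near=> lambda; have l0 : 0 < lambda by near: lambda; exact: nbhs_pinfty_gt.
  pose l := lambda / A; have lA : A * l = lambda by rewrite mulrC divfK// gt_eqF.
  have ll0 : 0 < l by rewrite divr_gt0.
  (* By the weak-type bound with total mass [M], this gives [L (ratlevel m l) < r], the smallness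
     under which [mr] applies. *)
  have lr : 3 ^+ d / l * M < r.
    rewrite mulrAC ltr_pdivrMr// -ltr_pdivrMl// /l ltr_pdivlMr//.
    by near: lambda; apply: nbhs_pinfty_gt; exact: num_real.
  have mO : measurable (ratlevel m l) by exact: measurable_ratlevel.
  have Lr : (L (ratlevel m l) < r%:E)%E.
    apply: le_lt_trans (ratlevel_weak_type m ll0) _.
    apply: (@le_lt_trans _ _ ((3 ^+ d / l)%:E * M%:E)%E); last by rewrite -EFinM lte_fin.
    by apply: lee_wpmul2l; [rewrite lee_fin divr_ge0// ltW|exact: mM].
  apply: (@le_trans _ _ (lambda%:E * L (ratlevel m l))%E).
    apply: lee_wpmul2l; first by rewrite lee_fin ltW.
    apply: le_lebesgueRV.
    by rewrite -{1}lA; exact: superlevel_sub_ratlevel.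
  apply: (@le_trans _ _ (lambda%:E * ((3 ^+ d / l)%:E * m (ratlevel m l)))%E).
    by apply: lee_wpmul2l; [rewrite lee_fin ltW|exact: ratlevel_weak_type].
  rewrite muleA -EFinM (_ : lambda * _ = k); last first.
    by rewrite -lA /k; field; rewrite gt_eqF.
  apply: (@le_trans _ _ (k%:E * (e / k)%:E)%E).
    apply: lee_wpmul2l; first by rewrite lee_fin ltW.
    by apply: ltW; exact: mr.
  by rewrite -EFinM mulrC divfK// gt_eqF.
have f0 lambda : 0 < lambda -> (0 <= lambda%:E * L (superlevel mu lambda))%E.
  by move=> l0; rewrite mule_ge0// lee_fin ltW.
apply/fine_cvgP; split.
  near=> lambda; rewrite ge0_fin_numE; last first.
    by apply: f0; near: lambda; exact: nbhs_pinfty_gt.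
  by apply: (@le_lt_trans _ _ 1%:E); [near: lambda; exact: small|exact: ltry].
apply/cvgr0Pnorm_le => e e0; near=> lambda.
have l0 : 0 < lambda by near: lambda; exact: nbhs_pinfty_gt.
have fe : (lambda%:E * L (superlevel mu lambda) <= e%:E)%E by near: lambda; exact: small.
rewrite /= ger0_norm ?fine_ge0 ?f0//.
rewrite -lee_fin fineK// ge0_fin_numE ?f0//.
exact: le_lt_trans fe (ltry _).
Unshelve. all: by end_near. Qed.

(** For a null set [N], [ratlevel_null] at level [A * lambda] bounds [m N] by [k] times the quantity
    tending to 0. *)
Lemma superlevel_cvg0_dominates (R : realType) (d : nat)
    (mu : {charge set (borelRV R d) -> \bar R}) :
  (lambda%:E * lebesgueRV R d (superlevel mu lambda))%E @[lambda --> +oo%R] --> 0%E ->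
  mu `<< lebesgueRV R d.
Proof.
move=> lim0; apply/null_content_dominatesP => N mN N0.
(* In dimension 0 the Lebesgue measure is a point mass, so a null set is empty. *)
have [d0|d0] := posnP d.
  suff -> : N = set0 by exact: charge0.
  subst d; rewrite -subset0 => x Nx; move: N0; rewrite /= diracE.
  have -> : 0 = x by apply/rowP; case.
  by rewrite mem_set// => -[] /eqP; rewrite oner_eq0.
set L := lebesgueRV R d in lim0; pose m := variation_measure mu.
set A := dilation_const R d; have A0 : 0 < A by exact: dilation_const_gt0.
suff mN0 : (m N <= 0)%E.
  apply/eqP; rewrite -abse_eq0 eq_le abse_ge0 andbT.
  by apply: le_trans mN0; exact: abse_charge_variation.
pose k : R := 3 ^+ d * A; have k0 : 0 < k by rewrite mulr_gt0.
rewrite -[leRHS](mule0 k%:E); apply: cvge_ge (cvgeZl _ lim0) => //.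
near=> lambda; have l0 : 0 < lambda by near: lambda; exact: nbhs_pinfty_gt.
apply: le_trans (ratlevel_null (variation_measure_fin mu) d0 (mulr_gt0 A0 l0) mN N0) _.
rewrite mulrA EFinM -muleA; apply: lee_wpmul2l; first by rewrite lee_fin ltW.
apply: lee_wpmul2l; first by rewrite lee_fin ltW.
apply: le_lebesgueRV.
exact: ratlevel_sub_superlevel.
Unshelve. all: by end_near. Qed.

Theorem corollary1p2 (R : realType) (d : nat)
    (mu : {charge set (borelRV R d) -> \bar R}) :
  mu `<< lebesgueRV R d <->
  (lambda%:E *
    lebesgueRV R d [set x : borelRV R d | (lambda%:E < maximal_function mu x)%E])%E
    @[lambda --> +oo%R] --> 0%E.
Proof. by split; [exact: superlevel_cvg0|exact: superlevel_cvg0_dominates]. Qed.
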